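(* For every nonzero integer $n$, the group $H_n$ is residually $2$ if and only if $n$ is odd.
   Context: Let $\mathbb{F}_2$ be the field with two elements, $t$ an indeterminate, and let $G$ be the subgroup of $\mathrm{GL}(3,\mathbb{F}_2[t,t^{-1}])$ generated by $c=\begin{pmatrix} t & 1+t & 1+t\\ 1+t & t & 1+t\\ 1+t & 1+t & t\end{pmatrix}$ and $d=\begin{pmatrix} t&0&0\\0&1&0\\0&0&1\end{pmatrix}$. For each nonzero integer $n$, let $\rho_n$ be the injective endomorphism of $\mathrm{GL}(3,\mathbb{F}_2[t,t^{-1}])$ obtained by substituting $t\mapsto t^n$ in every matrix entry. One has $\rho_n(c)=c^n$ and $\rho_n(d)=d^n$, so $\rho_n$ restricts to an injective endomorphism $\rho_n|_G:G\to G$. Let $H_n$ be the (ascending) HNN extension of $G$ by $\rho_n|_G$, i.e. $H_n=\langle G,\tau \mid \tau g\tau^{-1}=\rho_n(g),\ g\in G\rangle$. For a prime $p$, a group $\Gamma$ is residually $p$ if for every nontrivial $g\in\Gamma$ there is a homomorphism $h$ from $\Gamma$ to a finite $p$-group with $h(g)\neq 1$. *)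

(* Defs.v *)
From HB Require Import structures.
From mathcomp Require Import all_boot all_order all_algebra all_fingroup all_solvable.
From mathcomp Require Import boolp.
From mathcomp Require Import ring.

Set Implicit Arguments.
Unset Strict Implicit.
Unset Printing Implicit Defensive.

Import GRing.Theory.

Lemma unit_subr_div (R : comUnitRingType) (a b x y : R) :
    x \is a GRing.unit -> y \is a GRing.unit ->
  (a / x - b / y = (a * y - b * x) / (x * y))%R.
Proof.
move=> ux uy; rewrite invrM // [(y^-1 * _)%R]mulrC mulrBl.
by rewrite mulrACA (mulrV uy) mulr1 mulrA (mulrK ux).
Qed.

Lemma unit_mulr_div (R : comUnitRingType) (a b x y : R) :
    x \is a GRing.unit -> y \is a GRing.unit ->
  (a / x * (b / y) = (a * b) / (x * y))%R.
Proof. by move=> ux uy; rewrite invrM // mulrACA [(y^-1 * _)%R]mulrC. Qed.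

Section Laurent.
Variable F : fieldType.
Local Open Scope ring_scope.
Local Notation "p %:F" := (@FracField.tofrac _ p).

(* F[t, t^-1] as the subring of F(t) of the fractions p / t^k. *)
Definition is_laurent : pred {fraction {poly F}} :=
  fun x => `[< exists q : {poly F} * nat, x = q.1%:F / ('X%:F) ^+ q.2 >].

Lemma is_laurentP x :
  reflect (exists q : {poly F} * nat, x = q.1%:F / ('X%:F) ^+ q.2)
          (x \in is_laurent).
Proof. exact: asboolP. Qed.

Lemma tofracX_neq0 k : (('X : {poly F})%:F) ^+ k != 0 :> {fraction {poly F}}.
Proof. by rewrite expf_neq0 // tofrac_eq0 polyX_eq0. Qed.

Lemma is_laurent_subring : subring_closed is_laurent.
Proof.
split.
- by apply/is_laurentP; exists (1, 0%N); rewrite /= expr0 divr1 tofrac1.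
- move=> _ _ /is_laurentP[[p k] ->] /is_laurentP[[q m] ->] /=.
  apply/is_laurentP; exists (p * 'X^m - q * 'X^k, (k + m)%N) => /=.
  rewrite -mulNr addf_div ?tofracX_neq0 // mulNr -exprD.
  by rewrite tofracB !tofracM !tofracXn.
- move=> _ _ /is_laurentP[[p k] ->] /is_laurentP[[q m] ->] /=.
  apply/is_laurentP; exists (p * q, (k + m)%N) => /=.
  by rewrite mulf_div -exprD tofracM.
Qed.

Record laurent := Laurent { lval :> {fraction {poly F}}; _ : lval \in is_laurent }.

HB.instance Definition _ := [isSub for lval].
HB.instance Definition _ := [Choice of laurent by <:].
HB.instance Definition _ :=
  GRing.SubChoice_isSubComNzRing.Build _ is_laurent laurent is_laurent_subring.

Lemma lval0 : lval 0 = 0. Proof. exact: (rmorph0 (\val : laurent -> _)). Qed.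
Lemma lval1 : lval 1 = 1. Proof. exact: (rmorph1 (\val : laurent -> _)). Qed.
Lemma lvalD : {morph lval : x y / x + y}.
Proof. exact: (rmorphD (\val : laurent -> _)). Qed.
Lemma lvalN : {morph lval : x / - x}.
Proof. exact: (rmorphN (\val : laurent -> _)). Qed.
Lemma lvalM : {morph lval : x y / x * y}.
Proof. exact: (rmorphM (\val : laurent -> _)). Qed.
Lemma lval_eq0 x : (lval x == 0) = (x == 0).
Proof. by rewrite -lval0; apply: (inj_eq val_inj). Qed.

Definition laurent_unit : pred laurent :=
  fun x => (x != 0) && ((lval x)^-1 \in is_laurent).

Definition laurent_inv (x : laurent) : laurent := insubd x (lval x)^-1.

Lemma laurent_mulVr : {in laurent_unit, left_inverse 1 laurent_inv *%R}.
Proof.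
move=> x /andP[x0 xV]; apply: val_inj; rewrite [LHS]lvalM [RHS]lval1.
rewrite [lval (laurent_inv x)]val_insubd [_ \in _]xV mulVf; first by [].
by rewrite lval_eq0.
Qed.

Lemma laurent_unitPl (x y : laurent) : y * x = 1 -> laurent_unit x.
Proof.
move=> /(congr1 lval); rewrite lvalM lval1 => yx1.
have x0 : lval x != 0.
  by apply: contra_eq_neq yx1 => ->; rewrite mulr0 eq_sym oner_neq0.
apply/andP; split; first by rewrite -lval_eq0.
have -> : (lval x)^-1 = lval y by apply: (mulIf x0); rewrite mulVf // yx1.
exact: valP y.
Qed.

Lemma laurent_inv_out : {in [predC laurent_unit], laurent_inv =1 id}.
Proof.
move=> x; rewrite inE => nux; apply: val_inj; rewrite [LHS]val_insubd.
case: ifP => // xV; move: nux; rewrite -[_ \in _]/(laurent_unit x) /laurent_unit xV.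
by rewrite andbT negbK -lval_eq0 => /eqP xz; rewrite [RHS]xz xz invr0.
Qed.

HB.instance Definition _ := GRing.ComNzRing_hasMulInverse.Build laurent
  laurent_mulVr laurent_unitPl laurent_inv_out.

Lemma poly_is_laurent (p : {poly F}) : p%:F \in is_laurent.
Proof. by apply/is_laurentP; exists (p, 0%N); rewrite /= expr0 divr1. Qed.

Definition poly_laurent (p : {poly F}) : laurent :=
  Laurent (poly_is_laurent p).

Lemma poly_laurent_zmod : zmod_morphism poly_laurent.
Proof. by move=> p q; apply: val_inj; rewrite [RHS]lvalD lvalN [LHS]tofracB. Qed.

Lemma poly_laurent_monoid : monoid_morphism poly_laurent.
Proof.
split; first by apply: val_inj; rewrite [RHS]lval1 [LHS]tofrac1.
by move=> p q; apply: val_inj; rewrite [RHS]lvalM [LHS]tofracM.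
Qed.

HB.instance Definition _ :=
  GRing.isZmodMorphism.Build _ _ poly_laurent poly_laurent_zmod.
HB.instance Definition _ :=
  GRing.isMonoidMorphism.Build _ _ poly_laurent poly_laurent_monoid.

Definition lt : laurent := poly_laurent 'X.

Lemma poly_laurent_inj : injective poly_laurent.
Proof. by move=> p q /(congr1 lval)/eqP; rewrite tofrac_eq => /eqP. Qed.

Lemma lt_unit : lt \is a GRing.unit.
Proof.
change (laurent_unit lt); apply/andP; split.
  by rewrite -lval_eq0 tofrac_eq0 polyX_eq0.
by apply/is_laurentP; exists (1, 1%N); rewrite /= tofrac1 expr1 div1r.
Qed.

Lemma laurentE (x : laurent) :
  exists q : {poly F} * nat, x = poly_laurent q.1 / lt ^+ q.2.
Proof.
have /is_laurentP[q xq] := valP x; exists q.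
apply: (mulIr (unitrX q.2 lt_unit)).
rewrite divrK ?unitrX ?lt_unit // -rmorphXn; apply: val_inj.
by rewrite [LHS]lvalM [lval x]xq [lval (poly_laurent _)]tofracXn divfK ?tofracX_neq0.
Qed.

Section Eval.
Variables (A : comUnitRingType) (f : {rmorphism F -> A}) (u : A).

(* The value of x at t = u, for u a unit; it does not depend on the fraction
   chosen for x, see [laurent_evalE]. *)
Definition laurent_eval (x : laurent) : A :=
  let: (p, k) := projT1 (cid (laurentE x)) in (map_poly f p).[u] / u ^+ k.

Hypothesis u_unit : u \is a GRing.unit.

Lemma laurent_evalE p k :
  laurent_eval (poly_laurent p / lt ^+ k) = (map_poly f p).[u] / u ^+ k.
Proof.
rewrite /laurent_eval; case: cid => -[q m] /= e.
have {e} epq : p * 'X^m = q * 'X^k.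
  have uk := unitrX k lt_unit; have um := unitrX m lt_unit.
  have pq : poly_laurent p * lt ^+ m = poly_laurent q * lt ^+ k.
    by rewrite -[poly_laurent p](divrK uk) e mulrAC divrK.
  by apply: poly_laurent_inj; rewrite !rmorphM !rmorphXn; exact: pq.
apply: (mulIr (unitrX k u_unit)); rewrite divrK ?unitrX //.
apply: (mulIr (unitrX m u_unit)); rewrite mulrAC divrK ?unitrX //.
have := congr1 (fun z => (map_poly f z).[u]) epq.
by rewrite !rmorphM /= !hornerM !map_polyXn !hornerXn.
Qed.

Lemma laurent_eval_zmod : zmod_morphism laurent_eval.
Proof.
move=> x y; have [[p k] /= ->] := laurentE x; have [[q m] /= ->] := laurentE y.
have -> : poly_laurent p / lt ^+ k - poly_laurent q / lt ^+ m =
          poly_laurent (p * 'X^m - q * 'X^k) / lt ^+ (k + m).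
  by rewrite unit_subr_div ?unitrX ?lt_unit // exprD rmorphB !rmorphM !rmorphXn.
rewrite !laurent_evalE unit_subr_div ?unitrX // -exprD.
by rewrite rmorphB !rmorphM /= hornerD hornerN !hornerM !map_polyXn !hornerXn.
Qed.

Lemma laurent_eval_monoid : monoid_morphism laurent_eval.
Proof.
split.
  have -> : 1 = poly_laurent 1 / lt ^+ 0 by rewrite rmorph1 expr0 divr1.
  by rewrite laurent_evalE rmorph1 hornerC expr0 divr1.
move=> x y; have [[p k] /= ->] := laurentE x; have [[q m] /= ->] := laurentE y.
have -> : poly_laurent p / lt ^+ k * (poly_laurent q / lt ^+ m) =
          poly_laurent (p * q) / lt ^+ (k + m).
  by rewrite unit_mulr_div ?unitrX ?lt_unit // exprD rmorphM.
by rewrite !laurent_evalE unit_mulr_div ?unitrX // -exprD rmorphM hornerM.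
Qed.

End Eval.

Definition laurentC (a : F) : laurent := poly_laurent a%:P.
HB.instance Definition _ := GRing.RMorphism.copy laurentC (poly_laurent \o polyC).

(* The substitution of t^n for t. *)
Definition laurent_subst (n : int) : laurent -> laurent :=
  laurent_eval laurentC (lt ^ n).

Lemma lt_exprz_unit n : lt ^ n \is a GRing.unit.
Proof. exact/unitrXz/lt_unit. Qed.

HB.instance Definition _ n := GRing.isZmodMorphism.Build _ _ (laurent_subst n)
  (laurent_eval_zmod laurentC (lt_exprz_unit n)).
HB.instance Definition _ n := GRing.isMonoidMorphism.Build _ _ (laurent_subst n)
  (laurent_eval_monoid laurentC (lt_exprz_unit n)).

Lemma laurent_subst_lt n : laurent_subst n lt = lt ^ n.
Proof.
have {1}-> : lt = poly_laurent 'X / lt ^+ 0 by rewrite expr0 divr1.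
rewrite /laurent_subst laurent_evalE ?lt_exprz_unit //.
by rewrite map_polyX hornerX expr0 divr1.
Qed.

End Laurent.

Arguments lt {F}.
Arguments laurent_subst {F}.

Section Units.
Variable R : unitRingType.
Local Open Scope ring_scope.

Record units := Units { uval :> R; _ : uval \is a GRing.unit }.

HB.instance Definition _ := [isSub for uval].
HB.instance Definition _ := [Choice of units by <:].

Lemma unitr_mul (x y : R) :
  x \is a GRing.unit -> y \is a GRing.unit -> x * y \is a GRing.unit.
Proof. by move=> ux uy; rewrite unitrMl. Qed.
Lemma unitr_inv (x : R) : x \is a GRing.unit -> x^-1 \is a GRing.unit.
Proof. by rewrite unitrV. Qed.

Definition units_one : units := Units (unitr1 R).
Definition units_mul (x y : units) : units :=
  Units (unitr_mul (valP x) (valP y)).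
Definition units_inv (x : units) : units :=
  Units (unitr_inv (valP x)).

Lemma units_mulA : associative units_mul.
Proof. by move=> x y z; apply: val_inj; apply: mulrA. Qed.
Lemma units_mul1 : left_id units_one units_mul.
Proof. by move=> x; apply: val_inj; apply: mul1r. Qed.
Lemma units_mulr1 : right_id units_one units_mul.
Proof. by move=> x; apply: val_inj; apply: mulr1. Qed.
Lemma units_mulV : left_inverse units_one units_inv units_mul.
Proof. by move=> x; apply: val_inj; apply: mulVr (valP x). Qed.
Lemma units_mulrV : right_inverse units_one units_inv units_mul.
Proof. by move=> x; apply: val_inj; apply: mulrV (valP x). Qed.

HB.instance Definition _ := isGroup.Build units
  units_mulA units_mul1 units_mulr1 units_mulV units_mulrV.

End Units.

Section UnitsMap.
Variables (R S : unitRingType) (f : {rmorphism R -> S}).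

Definition units_map (x : units R) : units S :=
  Units (rmorph_unit f (valP x)).

Lemma units_mapM : {morph units_map : x y / (x * y)%g}.
Proof. by move=> x y; apply: val_inj; apply: rmorphM. Qed.
Lemma units_map1 : units_map 1%g = 1%g.
Proof. by apply: val_inj; apply: rmorph1. Qed.

HB.instance Definition _ :=
  isUMagmaMorphism.Build _ _ units_map (units_map1, units_mapM).

End UnitsMap.

Section Generated.
Variables (Gamma : groupType) (A : Gamma -> Prop).
Local Open Scope group_scope.

Inductive in_gen : Gamma -> Prop :=
| in_gen_mem x : A x -> in_gen x
| in_gen1 : in_gen 1
| in_genM x y : in_gen x -> in_gen y -> in_gen (x * y)
| in_genV x : in_gen x -> in_gen x^-1.

Definition in_genb : pred Gamma := fun x => `[< in_gen x >].

Lemma in_genP x : reflect (in_gen x) (x \in in_genb).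
Proof. exact: asboolP. Qed.

Record subgroup_gen := SubgroupGen { gen_val :> Gamma; _ : gen_val \in in_genb }.

HB.instance Definition _ := [isSub for gen_val].
HB.instance Definition _ := [Choice of subgroup_gen by <:].

Lemma in_gen_group : group_closed in_genb.
Proof.
split; first exact/in_genP/in_gen1.
move=> x y /in_genP gx /in_genP gy.
exact/in_genP/in_genM/in_genV.
Qed.

HB.instance Definition _ :=
  SubChoice_isSubGroup.Build _ in_genb subgroup_gen in_gen_group.

Definition zexpg (x : Gamma) (n : int) : Gamma :=
  match n with Posz k => x ^+ k | Negz k => x ^- k.+1 end.

Lemma in_gen_zexpg x n : in_gen x -> in_gen (zexpg x n).
Proof.
move=> gx; have gX k : in_gen (x ^+ k).
  by elim: k => [|k IH]; [exact: in_gen1 | rewrite expgS; apply: in_genM].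
by case: n => k; rewrite /zexpg; [|apply: in_genV].
Qed.

End Generated.

(* For a group endomorphism phi of G, the group
     < G, tau | tau g tau^-1 = phi g, g in G >,
   which is the ascending HNN extension of G by phi when phi is injective.
   It is built as the monoid of the words over G, tau and tau^-1, modulo the
   multiplication table of G, the cancellation of tau with tau^-1 and the
   relations above; [hnn_universal] is its universal property. *)
Section HNN.
Variables (G : groupType) (phi : UMagmaMorphism.type G G).
Local Open Scope group_scope.

(* [inl g] stands for g, [inr true] for tau and [inr false] for tau^-1. *)
Definition hnn_word := seq (G + bool).

Inductive hnn_eq : hnn_word -> hnn_word -> Prop :=
| hnn_eq1 : hnn_eq [:: inl 1] [::]
| hnn_eqM g h : hnn_eq [:: inl g; inl h] [:: inl (g * h)]
| hnn_eq_tau b : hnn_eq [:: inr b; inr (~~ b)] [::]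
| hnn_eq_conj g : hnn_eq [:: inr true; inl g; inr false] [:: inl (phi g)]
| hnn_eq_cat u u' v v' : hnn_eq u u' -> hnn_eq v v' -> hnn_eq (u ++ v) (u' ++ v')
| hnn_eq_refl u : hnn_eq u u
| hnn_eq_sym u v : hnn_eq u v -> hnn_eq v u
| hnn_eq_trans u v w : hnn_eq u v -> hnn_eq v w -> hnn_eq u w.

Definition hnn_eqb : rel hnn_word := fun u v => `[< hnn_eq u v >].

Lemma hnn_eqb_refl : reflexive hnn_eqb.
Proof. by move=> u; apply/asboolP/hnn_eq_refl. Qed.
Lemma hnn_eqb_sym : symmetric hnn_eqb.
Proof. by move=> u v; apply/asboolP/asboolP; apply: hnn_eq_sym. Qed.
Lemma hnn_eqb_trans : transitive hnn_eqb.
Proof.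
by move=> v u w /asboolP uv /asboolP vw; apply/asboolP/(hnn_eq_trans uv vw).
Qed.

Canonical hnn_equiv := EquivRel hnn_eqb hnn_eqb_refl hnn_eqb_sym hnn_eqb_trans.

Definition hnn := {eq_quot hnn_equiv}%qT.
HB.instance Definition _ := Choice.on hnn.
HB.instance Definition _ := EqQuotient.on hnn.

Definition hnn_class (u : hnn_word) : hnn := (\pi_hnn u)%qT.

Definition hnn_repr (x : hnn) : hnn_word := generic_quotient.repr x.

Lemma hnn_classP u v : hnn_class u = hnn_class v <-> hnn_eq u v.
Proof.
split=> [/eqP|uv]; first by rewrite (eqmodE hnn_equiv) => /asboolP.
by apply/eqP; rewrite (eqmodE hnn_equiv); apply/asboolP.
Qed.

Lemma hnn_classK (x : hnn) : hnn_class (hnn_repr x) = x.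
Proof. exact: reprK. Qed.

Definition hnn_winv (u : hnn_word) : hnn_word :=
  rev [seq match a with inl g => inl g^-1 | inr b => inr (~~ b) end | a <- u].

Lemma hnn_winv_cat u v : hnn_winv (u ++ v) = hnn_winv v ++ hnn_winv u.
Proof. by rewrite /hnn_winv map_cat rev_cat. Qed.

Lemma hnn_winvK : involutive hnn_winv.
Proof.
move=> u; rewrite /hnn_winv map_rev revK -map_comp -[RHS]map_id.
by apply: eq_map => -[g|b] /=; rewrite ?invgK ?negbK.
Qed.

Lemma hnn_winv_mul u : hnn_eq (hnn_winv u ++ u) [::].
Proof.
elim: u => [|a u IH]; first exact: hnn_eq_refl.
rewrite -cat1s hnn_winv_cat -catA.
apply: hnn_eq_trans IH; apply: hnn_eq_cat (hnn_eq_refl _) _.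
rewrite catA -[X in hnn_eq _ X]cat0s; apply: hnn_eq_cat (hnn_eq_refl _).
case: a => [g|b]; rewrite /hnn_winv /=.
  by apply: hnn_eq_trans (hnn_eqM _ _) _; rewrite mulVg; apply: hnn_eq1.
by rewrite -{2}[b]negbK; apply: hnn_eq_tau.
Qed.

Lemma hnn_mul_winv u : hnn_eq (u ++ hnn_winv u) [::].
Proof. by rewrite -{1}[u]hnn_winvK; apply: hnn_winv_mul. Qed.

Lemma hnn_winv_eq u v : hnn_eq u v -> hnn_eq (hnn_winv u) (hnn_winv v).
Proof.
move=> uv; rewrite -[hnn_winv u]cats0.
apply: hnn_eq_trans (hnn_eq_cat (hnn_eq_refl _) (hnn_eq_sym (hnn_mul_winv v))) _.
rewrite catA -[X in hnn_eq _ X]cat0s; apply: hnn_eq_cat (hnn_eq_refl _).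
apply: hnn_eq_trans (hnn_winv_mul u).
exact: hnn_eq_cat (hnn_eq_refl _) (hnn_eq_sym uv).
Qed.

Definition hnn_one : hnn := hnn_class [::].
Definition hnn_mul (x y : hnn) : hnn := hnn_class (hnn_repr x ++ hnn_repr y).
Definition hnn_inv (x : hnn) : hnn := hnn_class (hnn_winv (hnn_repr x)).

Lemma hnn_repr_class u : hnn_eq (hnn_repr (hnn_class u)) u.
Proof. by apply/hnn_classP; rewrite hnn_classK. Qed.

Lemma hnn_mulE u v : hnn_mul (hnn_class u) (hnn_class v) = hnn_class (u ++ v).
Proof. by apply/hnn_classP/hnn_eq_cat; apply: hnn_repr_class. Qed.

Lemma hnn_invE u : hnn_inv (hnn_class u) = hnn_class (hnn_winv u).
Proof. by apply/hnn_classP/hnn_winv_eq/hnn_repr_class. Qed.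

Lemma hnn_mulA : associative hnn_mul.
Proof.
move=> x y z; rewrite -(hnn_classK x) -(hnn_classK y) -(hnn_classK z).
by rewrite !hnn_mulE catA.
Qed.
Lemma hnn_mul1 : left_id hnn_one hnn_mul.
Proof. by move=> x; rewrite -(hnn_classK x) hnn_mulE. Qed.
Lemma hnn_mulr1 : right_id hnn_one hnn_mul.
Proof. by move=> x; rewrite -(hnn_classK x) hnn_mulE cats0. Qed.
Lemma hnn_mulV : left_inverse hnn_one hnn_inv hnn_mul.
Proof.
move=> x; rewrite -(hnn_classK x) hnn_invE hnn_mulE.
exact/hnn_classP/hnn_winv_mul.
Qed.
Lemma hnn_mulrV : right_inverse hnn_one hnn_inv hnn_mul.
Proof.
move=> x; rewrite -(hnn_classK x) hnn_invE hnn_mulE.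
exact/hnn_classP/hnn_mul_winv.
Qed.

HB.instance Definition _ := isGroup.Build hnn
  hnn_mulA hnn_mul1 hnn_mulr1 hnn_mulV hnn_mulrV.

Definition hnn_base (g : G) : hnn := hnn_class [:: inl g].
Definition hnn_tau : hnn := hnn_class [:: inr true].

Lemma hnn_baseM : {morph hnn_base : g h / g * h}.
Proof.
move=> g h; rewrite -[RHS]/(hnn_mul _ _) hnn_mulE.
exact/hnn_classP/hnn_eq_sym/hnn_eqM.
Qed.
Lemma hnn_base1 : hnn_base 1 = 1.
Proof. exact/hnn_classP/hnn_eq1. Qed.

HB.instance Definition _ :=
  isUMagmaMorphism.Build _ _ hnn_base (hnn_base1, hnn_baseM).

Lemma hnn_tauV : hnn_tau^-1 = hnn_class [:: inr false].
Proof. exact: hnn_invE. Qed.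

Lemma hnn_tauJ g : hnn_tau * hnn_base g * hnn_tau^-1 = hnn_base (phi g).
Proof.
rewrite hnn_tauV -[LHS]/(hnn_mul (hnn_mul _ _) _).
rewrite (hnn_mulE [:: inr true] [:: inl g]) hnn_mulE.
exact/hnn_classP/hnn_eq_conj.
Qed.

Section Universal.
Variables (K : groupType) (f : UMagmaMorphism.type G K) (s : K).
Hypothesis sJ : forall g, s * f g * s^-1 = f (phi g).

Definition hnn_weval (u : hnn_word) : K :=
  \prod_(a <- u) match a with inl g => f g | inr b => if b then s else s^-1 end.

Lemma hnn_weval_eq u v : hnn_eq u v -> hnn_weval u = hnn_weval v.
Proof.
rewrite /hnn_weval; elim=> {u v} [|g h|b|g|u u' v v' _ IHu _ IHv|//|//|u v w _ -> //].
- by rewrite big_seq1 big_nil gmulf1.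
- by rewrite !big_cons big_nil !mulg1 gmulfM.
- by rewrite !big_cons big_nil !mulg1; case: b; rewrite /= ?mulgV ?mulVg.
- by rewrite !big_cons big_nil !mulg1 mulgA sJ.
- by rewrite !big_cat IHu IHv.
Qed.

Lemma hnn_universal :
  exists2 h : UMagmaMorphism.type hnn K,
    (forall g, h (hnn_base g) = f g) /\ h hnn_tau = s &
    forall h' : UMagmaMorphism.type hnn K,
      (forall g, h' (hnn_base g) = f g) -> h' hnn_tau = s -> h' =1 h.
Proof.
pose h (x : hnn) := hnn_weval (hnn_repr x).
have hE u : h (hnn_class u) = hnn_weval u by apply/hnn_weval_eq/hnn_repr_class.
have hmorph : (h 1 = 1) * {morph h : x y / x * y}.
  split; first by rewrite (hE [::]) /hnn_weval big_nil.
  move=> x y; rewrite -(hnn_classK x) -(hnn_classK y).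
  by rewrite -[_ * _]/(hnn_mul _ _) hnn_mulE !hE /hnn_weval big_cat.
pose hM := isUMagmaMorphism.Build _ _ h hmorph.
pose H : UMagmaMorphism.type hnn K := HB.pack h hM.
exists H => [|h' h'f h's x].
  by split=> [g|]; rewrite /= hE /hnn_weval big_seq1.
rewrite /= -(hnn_classK x) hE; elim: (hnn_repr x) => [|a u IH].
  by rewrite /hnn_weval big_nil; apply: gmulf1.
have -> : hnn_class (a :: u) = hnn_class [:: a] * hnn_class u.
  by rewrite -[RHS]/(hnn_mul _ _) hnn_mulE.
rewrite gmulfM IH /hnn_weval big_cons; congr (_ * _).
case: a => [g|[]]; [exact: h'f | exact: h's | ].
by rewrite -hnn_tauV gmulfV h's.
Qed.

End Universal.

End HNN.

Section Matrices.
Local Open Scope ring_scope.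
Variable R : comUnitRingType.

Definition c_mx (u : R) : 'M[R]_3 := \matrix_(i, j) (if i == j then u else 1 + u).
Definition d_mx (u : R) : 'M[R]_3 := diag_mx (\row_j (if j == 0 then u else 1)).

Lemma d_mxM u v : d_mx (u * v) = d_mx u * d_mx v.
Proof.
rewrite /d_mx -[RHS]/(_ *m _) mulmx_diag; congr diag_mx.
by apply/rowP => j; rewrite !mxE; case: eqP; rewrite ?mulr1.
Qed.

Lemma d_mx1 : d_mx 1 = 1.
Proof.
rewrite -[RHS]/(1%:M) -diag_const_mx; congr diag_mx.
by apply/rowP => j; rewrite !mxE if_same.
Qed.

Hypothesis R2 : 2 \in [pchar R].

Lemma c_mxE u : c_mx u = 1%:M + (1 + u) *: const_mx 1.
Proof.
apply/matrixP => i j; rewrite !mxE mulr1; case: eqP => _; last by rewrite add0r.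
by rewrite addrA (addrr_pchar2 R2) add0r.
Qed.

Lemma c_mxM u v : c_mx (u * v) = c_mx u * c_mx v.
Proof.
set J : 'M[R]_3 := const_mx 1.
have JJ : J *m J = J.
  apply/matrixP => i j; rewrite !mxE (eq_bigr (fun=> 1)) => [|k _]; last first.
    by rewrite !mxE mulr1.
  by rewrite sumr_const card_ord mulrSr mulr2n (addrr_pchar2 R2) add0r.
rewrite !c_mxE -/J -[RHS]/(_ *m _) mulmxDl !mulmxDr !mul1mx mulmx1.
rewrite -!scalemxAl -!scalemxAr JJ scalerA -!addrA -!scalerDl; congr (_ + _ *: _).
transitivity (1 + u * v + 2%:R * (1 + u + v)); last by ring.
by rewrite (pcharf0 R2) mul0r addr0.
Qed.

Lemma c_mx1 : c_mx 1 = 1.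
Proof. by rewrite c_mxE (addrr_pchar2 R2) scale0r addr0. Qed.

End Matrices.

Section TheGroups.
Local Open Scope ring_scope.

Definition LF2 : comUnitRingType := laurent 'F_2.
Definition GL3 : groupType := units 'M[LF2]_3.

Lemma LF2_pchar2 : 2 \in [pchar LF2].
Proof.
have /pcharf0 f2 : 2 \in [pchar 'F_2] by apply: pchar_Fp.
apply/andP; split; first by [].
by rewrite -(rmorph_nat (@laurentC 'F_2)) f2 rmorph0.
Qed.

Lemma c_mx_unit (u : LF2) : u \is a GRing.unit -> c_mx u \is a GRing.unit.
Proof.
move=> uu; apply/unitrP; exists (c_mx u^-1).
by rewrite -!(c_mxM LF2_pchar2) mulVr // mulrV // (c_mx1 LF2_pchar2).
Qed.

Lemma d_mx_unit (u : LF2) : u \is a GRing.unit -> d_mx u \is a GRing.unit.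
Proof.
move=> uu; apply/unitrP; exists (d_mx u^-1).
by rewrite -!d_mxM mulVr // mulrV // d_mx1.
Qed.

Definition c_gen : GL3 := Units (c_mx_unit (lt_unit _)).
Definition d_gen : GL3 := Units (d_mx_unit (lt_unit _)).

Definition cd_gens : GL3 -> Prop := fun x => x = c_gen \/ x = d_gen.

Definition grpG : groupType := subgroup_gen cd_gens.

Definition rho (n : int) : UMagmaMorphism.type GL3 GL3 :=
  units_map (map_mx (laurent_subst n)).

Lemma uvalX (x : GL3) k : uval (x ^+ k)%g = uval x ^+ k.
Proof. by elim: k => // k IH; rewrite expgS exprS -IH. Qed.

Lemma uvalV (x : GL3) : uval x^-1%g = (uval x)^-1.
Proof. by []. Qed.

Lemma zexpg_family (m : LF2 -> 'M[LF2]_3) (x y : GL3) n :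
    m 1 = 1 -> {morph m : u v / u * v} ->
    uval x = m lt -> uval y = m (lt ^ n) ->
  y = zexpg x n.
Proof.
move=> m1 mM xE yE.
have mX k : m lt ^+ k = m (lt ^+ k).
  by elim: k => [|k IH]; rewrite ?expr0 ?m1 // !exprS IH -mM.
apply: val_inj; rewrite [LHS]yE; case: n {yE y} => k; rewrite /zexpg.
  by rewrite [RHS]uvalX xE mX.
rewrite [RHS]uvalV uvalX xE mX NegzE -exprnN.
have ul : lt ^+ k.+1 \is a @GRing.unit LF2 by rewrite unitrX ?lt_unit.
have um : m (lt ^+ k.+1) \is a GRing.unit.
  by apply/unitrP; exists (m (lt ^- k.+1)); rewrite -!mM mulVr // mulrV.
by apply: (mulIr um); rewrite mulVr // -mM mulVr.
Qed.

Lemma rho_c n : rho n c_gen = zexpg c_gen n.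
Proof.
apply: (zexpg_family (m := @c_mx LF2)) => //.
- exact: c_mx1 LF2_pchar2.
- exact: c_mxM LF2_pchar2.
apply/matrixP => i j; rewrite !mxE.
case: eqP => _; first exact: laurent_subst_lt.
by rewrite rmorphD rmorph1; congr (_ + _); apply: laurent_subst_lt.
Qed.

Lemma rho_d n : rho n d_gen = zexpg d_gen n.
Proof.
apply: (zexpg_family (m := @d_mx LF2)) => //.
- exact: d_mx1.
- exact: d_mxM.
apply/matrixP => i j; rewrite !mxE rmorphMn /=.
congr (_ *+ _); case: ifP => _; first exact: laurent_subst_lt.
exact: rmorph1.
Qed.

Lemma rho_cd_gen n x : in_gen cd_gens x -> in_gen cd_gens (rho n x).
Proof.
elim=> {x} [x [->|->]||x y _ IHx _ IHy|x _ IH].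
- by rewrite rho_c; apply/in_gen_zexpg/in_gen_mem; left.
- by rewrite rho_d; apply/in_gen_zexpg/in_gen_mem; right.
- by rewrite gmulf1; apply: in_gen1.
- by rewrite gmulfM; apply: in_genM.
- by rewrite gmulfV; apply: in_genV.
Qed.

Lemma rhoG_subproof n (x : grpG) : rho n (gen_val x) \in in_genb cd_gens.
Proof. by apply/in_genP/rho_cd_gen/in_genP/(valP x). Qed.

Definition rhoG (n : int) (x : grpG) : grpG := SubgroupGen (rhoG_subproof n x).

Lemma rhoG1 n : rhoG n 1%g = 1%g.
Proof.
apply: val_inj; rewrite -[LHS]/(rho n (gen_val 1%g)).
have -> : gen_val (1%g : grpG) = 1%g by [].
exact: gmulf1.
Qed.

Lemma rhoGM n : {morph rhoG n : x y / (x * y)%g}.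
Proof.
move=> x y; apply: val_inj; rewrite -[LHS]/(rho n (gen_val (x * y)%g)).
have -> : gen_val (x * y)%g = (gen_val x * gen_val y)%g by [].
exact: gmulfM.
Qed.

HB.instance Definition _ n :=
  isUMagmaMorphism.Build _ _ (rhoG n) (rhoG1 n, @rhoGM n).

Definition grpH (n : int) : groupType := hnn (rhoG n).

End TheGroups.

Definition residually (p : nat) (Gamma : groupType) : Prop :=
  forall g : Gamma, g <> 1%g ->
    exists (P : finGroupType) (h : UMagmaMorphism.type Gamma P),
      (p.-group [set: P])%g /\ h g <> 1%g.

(* Main.v *)
Require Import Defs.
From HB Require Import structures.
From mathcomp Require Import all_boot all_order all_algebra all_fingroup all_solvable.
From mathcomp Require Import boolp zify ring.

Set Implicit Arguments.
Unset Strict Implicit.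
Unset Printing Implicit Defensive.

Import GRing.Theory Pdiv.CommonRing Pdiv.RingMonic.

(** Both directions rest on finite quotients of G on which rho_n induces an
    automorphism. For N > 0 let Q = F_2[t]/(t^N - 1), the group algebra of Z/N. If n is
    invertible modulo N, then t |-> t^n is an automorphism sigma of Q of finite
    order. The matrices of G, reduced modulo t^N - 1, act on the finite set of
    rows over Q, sigma acts on it entrywise, and conjugation by sigma realizes
    rho_n. So H_n acts on the rows over Q ([row_substJ], [cd_repJ]).

    If n is odd, take N = 2^m. Modulo 1 + t the generators c and d are the
    identity, so every element of G is 1 + (1 + t)B. In characteristic 2 its
    2^m-th power is 1 + (1 + t^N) B^N, which is 1 over Q: elements of G act with
    2-power order ([cd_rep_2elt]). Since n^(2^m) = 1 modulo 2^m, sigma has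
    2-power order as well. The image of G is normalized by sigma, hence the
    image of H_n is a 2-group ([hnn_p_quotient]). For m large it detects a given
    nontrivial g in G, as a nonzero Laurent polynomial p / t^k stays nonzero in
    Q as soon as N exceeds the degree of p ([cd_rep_sep]). That is enough: every
    element of H_n is tau^-k g tau^l; for k <> l it is detected by a cyclic
    2-group through the exponent of tau, and for k = l it is conjugate to g
    ([hnn_residually]).

    If n is even, then in a finite 2-group c is conjugate to c^n, but raising to
    an even power lowers the order of a nontrivial 2-element. So c dies in every
    finite 2-group quotient ([zexpg_conj_pelt]). Yet c is not trivial in H_n, as
    it acts nontrivially on the rows over Q for N = |n| + 1 ([c_base_neq1]). *)

(** * Residually p HNN extensions by an endomorphism *)

Section HNNResidual.
Variables (G : groupType) (phi : UMagmaMorphism.type G G).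
Local Open Scope group_scope.
Local Notation base := (hnn_base phi).
Local Notation tau := (hnn_tau phi).

Lemma hnn_tau_base g : tau * base g = base (phi g) * tau.
Proof. by rewrite -hnn_tauJ mulgKV. Qed.

Lemma hnn_tauX_base k g : tau ^+ k * base g = base (iter k phi g) * tau ^+ k.
Proof.
elim: k => [|k IH]; first by rewrite expg0 mul1g mulg1.
by rewrite expgS -mulgA IH mulgA hnn_tau_base -mulgA.
Qed.

(** Since tau g = phi(g) tau, positive powers of tau can be moved to the right
    of the elements of the base and negative ones to the left. *)
Lemma hnn_normal_form (x : hnn phi) :
  exists k l g, x = tau ^- k * base g * tau ^+ l.
Proof.
rewrite -(hnn_classK x); elim: (hnn_repr x) => [|a u [k [l [g IH]]]].
  by exists 0, 0, 1; rewrite hnn_base1 expg0 invg1 !mulg1.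
have -> : hnn_class phi (a :: u) = hnn_class phi [:: a] * hnn_class phi u.
  by rewrite -[RHS]/(hnn_mul _ _) hnn_mulE.
rewrite {}IH; case: a => [h|[]].
- exists k, l, (iter k phi h * g); rewrite !mulgA; congr (_ * _).
  rewrite gmulfM mulgA; congr (_ * _).
  apply: (mulgI (tau ^+ k)); apply: (mulIg (tau ^+ k)).
  by rewrite !mulgA mulgKV mulgV mul1g; apply: hnn_tauX_base.
- case: k => [|k].
    exists 0, l.+1, (phi g).
    by rewrite expg0 invg1 !mul1g mulgA hnn_tau_base expgS mulgA.
  exists k, l, g; rewrite !mulgA; congr (_ * _ * _).
  by rewrite expgSr invgM mulKVg.
- exists k.+1, l, g; rewrite !mulgA; congr (_ * _ * _).
  by rewrite -hnn_tauV expgSr invgM.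
Qed.

Section PQuotient.
Variables (p : nat) (K : finGroupType) (f : UMagmaMorphism.type G K) (s : K).
Hypothesis sJ : forall g, s * f g * s^-1 = f (phi g).
Hypotheses (f_p : forall g, p.-elt (f g)) (s_p : p.-elt s).

Let A : {set K} := [set x | `[< exists g, x = f g >]].

Let A_group : group_set A.
Proof.
apply/group_setP; split=> [|x y].
  by rewrite inE; apply/asboolP; exists 1; rewrite gmulf1.
rewrite !inE => /asboolP[g ->] /asboolP[h ->].
by apply/asboolP; exists (g * h); rewrite gmulfM.
Qed.

Let f_in g : f g \in A.
Proof. by rewrite inE; apply/asboolP; exists g. Qed.

(** The relation [sJ] makes s normalize the image of f, so the two generate the
    product of a p-group by a cyclic p-group that normalizes it: a p-group. *)
Lemma hnn_p_quotient :
  exists (P : finGroupType) (h : UMagmaMorphism.type (hnn phi) P),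
    p.-group [set: P] /\ forall g, h (base g) = 1 -> f g = 1.
Proof.
pose B := Group A_group; pose L := (B <*> <[s]>)%G.
have sN : s \in 'N(B).
  (* Conjugation by s^-1 maps A into A, hence onto A because A is finite. *)
  rewrite -groupV; apply/normP/eqP; rewrite eqEcard cardJg leqnn andbT.
  apply/subsetP => _ /imsetP[x + ->]; rewrite inE => /asboolP[g ->].
  by rewrite /conjg invgK mulgA sJ f_in.
have BP : p.-group B.
  apply/pgroupP => q q_pr /(Cauchy q_pr)[x + xq]; rewrite inE => /asboolP[g xE].
  by have /pnatP := f_p g; rewrite -xE xq prime_gt0 // => /(_ isT); apply.
have LP : p.-group L.
  rewrite -[pgroup _ L]/(pgroup p (B <*> <[s]>%G)) norm_joinEr ?cycle_subG //.
  by rewrite pgroupM BP.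
have fL g : f g \in L by apply: (subsetP (joing_subl _ _)); apply: f_in.
have sL : s \in L by apply: (subsetP (joing_subr _ _)); apply: cycle_id.
have f1 : subg L (f 1) = 1 by rewrite gmulf1; apply: val_inj; rewrite /= subgK.
have fM : {morph (fun g => subg L (f g)) : x y / x * y}.
  by move=> x y; rewrite /= gmulfM subgM ?fL.
pose fL' : UMagmaMorphism.type G (subg_of L) :=
   HB.pack (fun g => subg L (f g)) (isUMagmaMorphism.Build _ _ _ (f1, fM)).
have [|h [hf hs] _] := @hnn_universal _ phi _ fL' (subg L s).
  by move=> g; apply: val_inj; rewrite /= !subgK ?fL ?sJ.
exists (subg_of L), h; split; first by rewrite -im_subg morphim_pgroup.
by move=> g; rewrite hf => /(congr1 val); rewrite /= subgK.
Qed.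

End PQuotient.

(** The exponent of tau is a homomorphism to the integers, which are residually
    p. *)
Lemma hnn_p_quotient_tau p (k l : nat) : prime p -> k != l ->
  exists (P : finGroupType) (h : UMagmaMorphism.type (hnn phi) P),
    [/\ p.-group [set: P], forall g, h (base g) = 1 & h tau ^+ k != h tau ^+ l].
Proof.
move=> p_pr kl; set q := (p ^ (k + l))%N.
have q0 : 0 < q by rewrite expn_gt0 prime_gt0.
have kq : k + l < q by rewrite ltn_expl ?prime_gt1.
pose P : finGroupType := 'I_q.-1.+1.
pose f : UMagmaMorphism.type G P := HB.pack (fun _ : G => 1 : P)
  (isUMagmaMorphism.Build _ _ (fun _ : G => 1 : P)
     (erefl, fun _ _ => esym (mulg1 _))).
have [|h [hf hs] _] := @hnn_universal _ phi _ f (Zp1 : P).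
  by move=> g; rewrite /= mulg1 mulgV.
exists P, h; split=> //.
  by rewrite /pgroup cardsT card_ord prednK // pnatX pnat_id.
rewrite hs eq_expg_mod_order order_Zp1 prednK // !modn_small //.
  exact: leq_ltn_trans (leq_addl _ _) kq.
exact: leq_ltn_trans (leq_addr _ _) kq.
Qed.

(** An element tau^-k g tau^l with k <> l is detected by the exponent of tau, and
    with k = l it is a conjugate of g. So only G has to be separated,
    by homomorphisms that take p-elements as values and turn phi into
    conjugation by a p-element. *)
Lemma hnn_residually p : prime p ->
    (forall g : G, g <> 1 ->
      exists (K : finGroupType) (f : UMagmaMorphism.type G K) (s : K),
        [/\ forall g, s * f g * s^-1 = f (phi g), forall g, p.-elt (f g),
            p.-elt s & f g <> 1]) ->
  residually p (hnn phi).
Proof.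
move=> p_pr sep x; have [k [l [g ->]]] := hnn_normal_form x => x1.
have [ekl|kl] := eqVneq k l; last first.
  have [P [h [pP hf hkl]]] := hnn_p_quotient_tau p_pr kl.
  exists P, h; split=> //; apply/eqP; apply: contraNneq hkl.
  rewrite !gmulfM gmulfV !gmulfXn hf mulg1 => /eqP.
  by rewrite -eq_invg_mul invgK => /eqP ->.
have [|K [f [s [sJ f_p s_p fg]]]] := sep g.
  by move=> g1; apply: x1; rewrite g1 hnn_base1 mulg1 ekl mulVg.
have [P [h [pP hP]]] := hnn_p_quotient sJ f_p s_p.
exists P, h; split=> // hx; apply/fg/hP.
apply: (mulIg (h tau ^+ l)); apply: (mulgI (h tau ^- k)).
by move: hx; rewrite !gmulfM gmulfV !gmulfXn mul1g ekl mulVg mulgA.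
Qed.

End HNNResidual.


(** * Substitutions in Laurent polynomials *)

Section LaurentMorphisms.
Variable F : fieldType.
Local Open Scope ring_scope.

Lemma laurent_morph_ext (A : comUnitRingType) (f g : {rmorphism laurent F -> A}) :
  (forall a, f (laurentC a) = g (laurentC a)) -> f lt = g lt -> f =1 g.
Proof.
move=> fgC fgt x; have [[p k] /= ->] := laurentE x.
have fgp : f (poly_laurent p) = g (poly_laurent p).
  elim/poly_ind: p => [|p a IH]; first by rewrite !rmorph0.
  rewrite !rmorphD !rmorphM /= IH -[poly_laurent 'X]/lt fgt.
  by rewrite -[poly_laurent a%:P]/(laurentC a) fgC.
have tk := unitrX k (lt_unit F).
apply: (mulIr (rmorph_unit f tk)); rewrite -(rmorphM f) divrK // fgp.
by rewrite (rmorphXn f) fgt -(rmorphXn g) -(rmorphM g) divrK.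
Qed.

Lemma laurent_evalC (A : comUnitRingType) (f : {rmorphism F -> A}) (u : A) a :
  u \is a GRing.unit -> laurent_eval f u (laurentC a) = f a.
Proof.
move=> uu; rewrite -[laurentC a]divr1 -(expr0 lt) laurent_evalE //.
by rewrite map_polyC hornerC expr0 divr1.
Qed.

Lemma laurent_substC n (a : F) : laurent_subst n (laurentC a) = laurentC a.
Proof. by rewrite /laurent_subst laurent_evalC ?lt_exprz_unit. Qed.

Lemma laurent_substM m n (x : laurent F) :
  laurent_subst m (laurent_subst n x) = laurent_subst (m * n) x.
Proof.
apply: (laurent_morph_ext (f := laurent_subst m \o laurent_subst n)) => [a|] /=.
  by rewrite !laurent_substC.
by rewrite !laurent_subst_lt rmorphXz ?lt_unit //= laurent_subst_lt exprz_exp.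
Qed.

Lemma laurent_subst1 (x : laurent F) : laurent_subst 1 x = x.
Proof.
apply: (laurent_morph_ext (g := idfun)) => [a|] /=.
  by rewrite !laurent_substC.
by rewrite laurent_subst_lt.
Qed.

Lemma iter_laurent_subst n k (x : laurent F) :
  iter k (laurent_subst n) x = laurent_subst (n ^+ k) x.
Proof.
elim: k => [|k IH] /=; first by rewrite expr0 laurent_subst1.
by rewrite IH laurent_substM -exprS.
Qed.

End LaurentMorphisms.

(** * Reduction modulo t^N - 1 *)

Section CyclicQuotient.
Variables (F : finFieldType) (N : nat).
Hypothesis N_gt0 : (0 < N)%N.
Local Open Scope ring_scope.

Definition cyclic_poly : {poly F} := 'X^N - 1.
Local Notation h := cyclic_poly.
Definition cyclic_alg := {poly %/ h}.
HB.instance Definition _ := GRing.ComUnitRing.on cyclic_alg.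
HB.instance Definition _ := Finite.on cyclic_alg.
Local Notation Q := cyclic_alg.

Lemma mk_monic_cyclic : mk_monic h = h.
Proof. by rewrite /mk_monic size_Xn_sub_1 // ltnS N_gt0 monic_Xn_sub_1. Qed.

Lemma cyclicX_expN : ('qX : Q) ^+ N = 1.
Proof.
apply/eqP; rewrite -subr_eq0; apply/eqP.
rewrite -[LHS]/(('qX : {poly %/ h}) ^+ N - 1) -rmorphXn.
rewrite -(rmorph1 (in_qpoly h)) -rmorphB.
by apply: val_inj; rewrite /= mk_monic_cyclic rmodpp ?monic_Xn_sub_1.
Qed.

Lemma cyclicX_unit : ('qX : Q) \is a GRing.unit.
Proof. by rewrite -(unitrX_pos _ N_gt0) cyclicX_expN unitr1. Qed.

Definition cyclic_ev : {rmorphism laurent F -> Q} :=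
  HB.pack (laurent_eval (qpolyC h) 'qX)
    (GRing.isZmodMorphism.Build _ _ _ (laurent_eval_zmod (qpolyC h) cyclicX_unit))
    (GRing.isMonoidMorphism.Build _ _ _
       (laurent_eval_monoid (qpolyC h) cyclicX_unit)).

Lemma cyclic_ev_lt : cyclic_ev lt = 'qX.
Proof.
rewrite -[lt in LHS]divr1 -(expr0 lt) /= laurent_evalE ?cyclicX_unit //.
by rewrite map_polyX hornerX expr0 divr1.
Qed.

Lemma cyclic_evC a : cyclic_ev (laurentC a) = qpolyC h a.
Proof. exact: laurent_evalC cyclicX_unit. Qed.

Lemma cyclic_ev_poly p : cyclic_ev (poly_laurent p) = in_qpoly h p.
Proof.
elim/poly_ind: p => [|p a IH]; first by rewrite !rmorph0.
rewrite !rmorphD !rmorphM IH; congr (_ * _ + _); first exact: cyclic_ev_lt.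
rewrite [LHS]cyclic_evC; apply: val_inj => /=.
rewrite rmodp_small // mk_monic_cyclic size_Xn_sub_1 //.
by rewrite (leq_ltn_trans (size_polyC_leq1 _)).
Qed.

Lemma cyclic_ev_polyK (q : Q) : cyclic_ev (poly_laurent (q : {poly %/ h})) = q.
Proof.
rewrite cyclic_ev_poly; apply: val_inj.
exact: in_qpoly_small (size_mk_monic q).
Qed.

Lemma cyclic_ev_poly_neq0 (p : {poly F}) :
  p != 0 -> (size p <= N)%N -> cyclic_ev (poly_laurent p) != 0.
Proof.
move=> p0 sp; rewrite cyclic_ev_poly; apply: contraNneq p0 => /(congr1 val) /=.
by rewrite rmodp_small ?mk_monic_cyclic ?size_Xn_sub_1 // => ->.
Qed.

(** Modulo t^N - 1, the exponent of t matters only modulo N. *)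
Lemma cyclic_ev_subst_cancel (k : int) x :
  (exists z, k = 1 + N%:Z * z) -> cyclic_ev (laurent_subst k x) = cyclic_ev x.
Proof.
case=> z ->.
apply: (laurent_morph_ext (f := cyclic_ev \o laurent_subst _)) => [a|].
  by rewrite -[LHS]/(cyclic_ev (laurent_subst _ (laurentC a))) laurent_substC.
rewrite -[LHS]/(cyclic_ev (laurent_subst _ lt)) laurent_subst_lt.
rewrite rmorphXz ?lt_unit // cyclic_ev_lt exprzDr ?cyclicX_unit // -exprz_exp.
by rewrite -[_ ^ N%:Z]/('qX ^+ N) cyclicX_expN exp1rz expr1z mulr1.
Qed.

Lemma cyclic_ev_subst_poly n :
  cyclic_ev (laurent_subst n (poly_laurent ('X^N - 1))) = 0.
Proof.
have -> : poly_laurent ('X^N - 1) = lt ^+ N - 1 :> laurent F.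
  by rewrite rmorphB rmorphXn rmorph1.
rewrite (rmorphB (laurent_subst n)) rmorphXn rmorph1.
rewrite [X in X ^+ _]laurent_subst_lt.
rewrite (rmorphB cyclic_ev) (rmorphXn cyclic_ev) rmorph1 rmorphXz ?lt_unit //.
rewrite cyclic_ev_lt exprnP exprz_exp mulrC -exprz_exp -exprnP cyclicX_expN.
by rewrite exp1rz subrr.
Qed.

(** Substituting t^n for t in a multiple of t^N - 1 gives a multiple of
    t^(nN) - 1, which t^N - 1 divides. *)
Lemma cyclic_ev_subst_eq0 n y :
  cyclic_ev y = 0 -> cyclic_ev (laurent_subst n y) = 0.
Proof.
have [[p k]] := laurentE y; rewrite [(p, k).1]/= [(p, k).2]/= => -> yp0.
have tk := unitrX k (lt_unit F).
have hp : in_qpoly h p = 0.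
  rewrite -cyclic_ev_poly -[poly_laurent p](divrK tk) (rmorphM cyclic_ev).
  by rewrite yp0 mul0r.
have {hp} -> : p = rdivp p h * ('X^N - 1).
  have := congr1 val hp; rewrite /= mk_monic_cyclic => hp'.
  by rewrite {1}(rdivp_eq (monic_Xn_sub_1 F N_gt0) p) hp' addr0.
by rewrite !rmorphM cyclic_ev_subst_poly mulr0 mul0r.
Qed.

(** The substitution of t^n for t in the quotient, computed on the
    representative of degree less than N. *)
Definition cyclic_subst n (q : Q) : Q :=
  cyclic_ev (laurent_subst n (poly_laurent (q : {poly %/ h}))).

Lemma cyclic_substE n x :
  cyclic_subst n (cyclic_ev x) = cyclic_ev (laurent_subst n x).
Proof.
apply/eqP; rewrite -subr_eq0 /cyclic_subst -(rmorphB cyclic_ev).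
rewrite -(rmorphB (laurent_subst n)).
by rewrite cyclic_ev_subst_eq0 // (rmorphB cyclic_ev) cyclic_ev_polyK subrr.
Qed.

Lemma cyclic_subst_zmod n : zmod_morphism (cyclic_subst n).
Proof.
move=> q r; rewrite -(cyclic_ev_polyK q) -(cyclic_ev_polyK r) -(rmorphB cyclic_ev).
by rewrite !cyclic_substE (rmorphB (laurent_subst n)) (rmorphB cyclic_ev).
Qed.

Lemma cyclic_subst_monoid n : monoid_morphism (cyclic_subst n).
Proof.
split.
  by rewrite -(rmorph1 cyclic_ev) cyclic_substE (rmorph1 (laurent_subst n)).
move=> q r; rewrite -(cyclic_ev_polyK q) -(cyclic_ev_polyK r) -(rmorphM cyclic_ev).
by rewrite !cyclic_substE (rmorphM (laurent_subst n)) (rmorphM cyclic_ev).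
Qed.

HB.instance Definition _ n :=
  GRing.isZmodMorphism.Build _ _ (cyclic_subst n) (cyclic_subst_zmod n).
HB.instance Definition _ n :=
  GRing.isMonoidMorphism.Build _ _ (cyclic_subst n) (cyclic_subst_monoid n).

(** * The action on rows over the quotient *)

Section Representation.
Variables (d : nat) (n : int) (k : nat).
Hypotheses (k_gt0 : (0 < k)%N) (nk : exists z, n ^+ k = 1 + N%:Z * z).
Local Notation GLL := (units 'M[laurent F]_d.+1).
Local Notation V := 'rV[Q]_d.+1.

Definition mx_ev : {rmorphism 'M[laurent F]_d.+1 -> 'M[Q]_d.+1} := map_mx cyclic_ev.

Lemma mx_evE M i j : mx_ev M i j = cyclic_ev (M i j).
Proof. by rewrite -[mx_ev M]/(map_mx cyclic_ev M) mxE. Qed.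

Lemma row_mul_inj (x : GLL) : injective (fun v : V => v *m mx_ev (uval x)).
Proof.
move=> v w; have ux := rmorph_unit mx_ev (valP x).
by move/(congr1 (mulmx^~ (invmx (mx_ev (uval x))))); rewrite /= !mulmxK.
Qed.

(** Permutations compose from left to right, so rows with right multiplication
    give a homomorphism. *)
Definition row_mul (x : GLL) : {perm V} := perm (@row_mul_inj x).

Lemma row_mul1 : row_mul 1%g = 1%g.
Proof. by apply/permP => v; rewrite permE perm1 [mx_ev _]rmorph1 mulmx1. Qed.

Lemma row_mulM : {morph row_mul : x y / (x * y)%g}.
Proof.
by move=> x y; apply/permP => v; rewrite permM !permE [mx_ev _]rmorphM mulmxA.
Qed.

HB.instance Definition _ := isUMagmaMorphism.Build _ _ row_mul (row_mul1, row_mulM).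

Lemma row_mul_eq1 x : row_mul x = 1%g <-> mx_ev (uval x) = 1.
Proof.
split=> [/permP x1|x1]; last by apply/permP => v; rewrite permE perm1 x1 mulmx1.
apply/row_matrixP => i.
by have := x1 (delta_mx 0 i); rewrite permE perm1 -rowE row1.
Qed.

Lemma row_subst_iter (v : V) : iter k (map_mx (cyclic_subst n)) v = v.
Proof.
have iterE j l (w : V) :
    iter l (map_mx (cyclic_subst n)) w 0 j = iter l (cyclic_subst n) (w 0 j).
  by elim: l => //= l <-; rewrite mxE.
have iter_ev l x :
    iter l (cyclic_subst n) (cyclic_ev x) = cyclic_ev (iter l (laurent_subst n) x).
  by elim: l => //= l ->; rewrite cyclic_substE.
apply/rowP => j; rewrite iterE -(cyclic_ev_polyK (v 0 j)) iter_ev.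
by rewrite iter_laurent_subst cyclic_ev_subst_cancel.
Qed.

Lemma row_subst_inj : injective (map_mx (cyclic_subst n) : V -> V).
Proof.
move=> v w; rewrite -{2}(row_subst_iter v) -{2}(row_subst_iter w).
by rewrite -(prednK k_gt0) !iterSr => ->.
Qed.

Definition row_subst : {perm V} := perm row_subst_inj.

Lemma row_subst_exp : (row_subst ^+ k)%g = 1%g.
Proof.
apply/permP => v; rewrite permX perm1 -[RHS]row_subst_iter.
by apply: eq_iter => w; rewrite permE.
Qed.

(** For a ring automorphism sigma, sigma (v M) = sigma v sigma M. *)
Lemma row_substJ x :
  (row_subst^-1 * row_mul x * row_subst)%g =
  row_mul (units_map (map_mx (laurent_subst n)) x).
Proof.
apply: (mulgI row_subst); rewrite -mulgA mulKVg.
apply/permP => v; rewrite !permM !permE map_mxM; congr (_ *m _).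
by apply/matrixP => i j; rewrite mxE !mx_evE [LHS]cyclic_substE [in RHS]mxE.
Qed.

End Representation.
End CyclicQuotient.

(** * Elements of G modulo 1 + t *)

Section CharTwo.
Local Open Scope ring_scope.

Lemma expr1D_pchar2 (R : nzRingType) (x : R) m :
  2 \in [pchar R] -> (1 + x) ^+ (2 ^ m) = 1 + x ^+ (2 ^ m).
Proof.
move=> R2; elim: m => [|m IH]; first by rewrite !expr1.
rewrite expnSr exprM IH exprM addrC sqrrD1 addrC.
by rewrite mulr2n (addrr_pchar2 R2) addr0.
Qed.

Lemma invr_congr1 (R : comUnitRingType) (A : unitAlgType R) (s : R) (u b : A) :
  u \is a GRing.unit -> u = 1 + s *: b -> u^-1 = 1 + s *: - (u^-1 * b).
Proof.
move=> uu uE; rewrite scalerN scalerAr; apply/eqP; rewrite eq_sym subr_eq; apply/eqP.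
by rewrite -{1}[u^-1]mulr1 -mulrDr -uE mulVr.
Qed.

(** At t = 1 both c and d become the identity matrix, and the matrices congruent
    to 1 modulo 1 + t form a group. *)
Lemma cd_gens_congr1 (x : GL3) : in_gen cd_gens x ->
  exists B : 'M[LF2]_3, uval x = 1 + (1 + lt) *: B.
Proof.
elim=> {x} [x [->|->]||x y _ [A xE] _ [B yE]|x _ [A xE]].
- by exists (const_mx 1); apply: c_mxE LF2_pchar2 _.
- exists (delta_mx 0 0); apply/matrixP => i j; rewrite !mxE.
  have [<-|ij] := eqVneq i j; last first.
    rewrite mulr0n add0r; case: (eqVneq i 0) ij => [->|_ _] /=.
      by rewrite eq_sym => /negPf ->; rewrite mulr0.
    by rewrite mulr0.
  rewrite andbb mulr1n; case: eqP => _; rewrite ?mulr1 ?mulr0 ?addr0 //.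
  by rewrite addrA (addrr_pchar2 LF2_pchar2) add0r.
- by exists 0; rewrite scaler0 addr0.
- exists (A + B + (1 + lt) *: (A * B)).
  rewrite -[LHS]/(uval x * uval y) xE yE mulrDl mul1r mulrDr mulr1.
  rewrite -scalerAl -scalerAr !scalerDr -!addrA; congr (_ + _).
  by rewrite addrCA.
- by exists (- ((uval x)^-1 * A)); apply: invr_congr1 (valP x) xE.
Qed.

(** If a = n^(2^m) is 1 modulo 2^m, then 2^(m+1) divides
    a^2 - 1 = (a - 1)(a + 1), as a is odd. *)
Lemma exists_pow2_odd n m : odd `|n|%N ->
  exists z : int, n ^+ (2 ^ m) = 1 + (2 ^ m)%N%:Z * z.
Proof.
move=> n_odd; elim: m => [|m [z IH]].
  by exists (n - 1); rewrite expr1 mul1r addrC subrK.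
have [y nE] : exists y : int, n ^+ (2 ^ m) = 1 + 2%:Z * y.
  have : odd `|n ^+ (2 ^ m)|%N by rewrite abszX oddX n_odd orbT.
  case: (n ^+ _) => j /= j_odd.
    exists (j./2)%:Z; rewrite -{1}(odd_double_half j) j_odd PoszD -muln2.
    by rewrite PoszM mulrC.
  exists (- (j./2.+1)%:Z); rewrite NegzE -{1}(odd_double_half j) (negPf j_odd).
  by rewrite -muln2; lia.
exists (z * (1 + y)); rewrite expnSr exprM PoszM; set a := n ^+ (2 ^ m) in IH nE *.
have -> : a ^+ 2 = 1 + (a - 1) * (a + 1) by ring.
by rewrite {1}IH nE; ring.
Qed.

End CharTwo.

(** * Odd n *)

Section Answer.
Local Open Scope ring_scope.

Lemma gmulf_zexpg (G H : groupType) (f : UMagmaMorphism.type G H) x n :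
  f (zexpg x n) = zexpg (f x) n.
Proof. by case: n => k; rewrite /zexpg ?gmulfV gmulfXn. Qed.

Definition gen_val_morph : UMagmaMorphism.type grpG GL3 :=
  HB.pack (@gen_val _ cd_gens)
    (isUMagmaMorphism.Build grpG GL3 (@gen_val _ cd_gens) (erefl, fun _ _ => erefl)).

Section CyclicRepresentation.
Variables (N : nat) (N_gt0 : (0 < N)%N) (n : int) (k : nat).
Hypotheses (k_gt0 : (0 < k)%N) (nk : exists z, n ^+ k = 1 + N%:Z * z).

Definition cd_rep (g : grpG) : {perm 'rV[cyclic_alg 'F_2 N]_3} :=
  row_mul N_gt0 (gen_val g).

Lemma cd_rep1 : cd_rep 1%g = 1%g. Proof. exact: row_mul1. Qed.
Lemma cd_repM : {morph cd_rep : x y / (x * y)%g}.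
Proof. by move=> x y; exact: row_mulM. Qed.

HB.instance Definition _ :=
  isUMagmaMorphism.Build _ _ cd_rep (cd_rep1, cd_repM).

Lemma cd_repJ g :
  let s := row_subst 'F_2 N_gt0 2 k_gt0 nk in
  (s^-1 * cd_rep g * s^-1^-1)%g = cd_rep (rhoG n g).
Proof. by rewrite /= invgK; apply: row_substJ. Qed.

End CyclicRepresentation.

(** (1 + (1 + t)B)^N = 1 + (1 + t^N) B^N for N = 2^m in characteristic 2, and
    1 + t^N vanishes in the quotient. *)
Lemma cd_rep_2elt m (N_gt0 : (0 < 2 ^ m)%N) g : (2.-elt (cd_rep N_gt0 g))%g.
Proof.
rewrite /p_elt (pnat_dvd (n := 2 ^ m)) ?pnatX // order_dvdn -gmulfXn.
have ev2 : cyclic_ev 'F_2 N_gt0 (1 + lt ^+ (2 ^ m)) = 0.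
  have := rmorphD (cyclic_ev 'F_2 N_gt0) 1 1.
  rewrite (addrr_pchar2 LF2_pchar2) rmorph0 rmorph1 => /esym e2.
  rewrite (rmorphD (cyclic_ev _ _)) rmorph1 (rmorphXn (cyclic_ev _ _)).
  by rewrite cyclic_ev_lt cyclicX_expN.
have [B xE] := cd_gens_congr1 (in_genP _ _ (valP g)).
have e : mx_ev 'F_2 N_gt0 2 (uval (gen_val g) ^+ (2 ^ m)) = 1.
  have M2 : 2 \in [pchar 'M[LF2]_3].
    by rewrite inE /= -scaler_nat (pcharf0 LF2_pchar2) scale0r.
  rewrite xE expr1D_pchar2 // exprZn (expr1D_pchar2 _ _ LF2_pchar2).
  rewrite (rmorphD (mx_ev _ _ _)) rmorph1 -[RHS]addr0; congr (_ + _).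
  by apply/matrixP => i j; rewrite mx_evE !mxE (rmorphM (cyclic_ev _ _)) ev2 mul0r.
apply/eqP/row_mul_eq1; rewrite -e; congr (mx_ev _ _ _ _).
by rewrite -[gen_val _]/(gen_val_morph _) gmulfXn uvalX.
Qed.

(** A nonzero entry p / t^k of g - 1 stays nonzero modulo t^N - 1 once N exceeds
    the degree of p. *)
Lemma cd_rep_sep (g : grpG) : g <> 1%g ->
  exists N0 : nat, forall N (N_gt0 : (0 < N)%N),
    (N0 <= N)%N -> cd_rep N_gt0 g <> 1%g.
Proof.
move=> g1; have [[i j] ij] : exists ij,
    uval (gen_val g) ij.1 ij.2 != (1 : 'M[LF2]_3) ij.1 ij.2.
  apply: contrapT => /forallNP noij; apply/g1/val_inj/val_inj/matrixP => i j.
  by apply/eqP/negPn/negP; apply: (noij (i, j)).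
set x := (uval (gen_val g) i j - (1 : 'M[LF2]_3) i j).
have x0 : x != 0 by rewrite subr_eq0.
have [[p k]] := laurentE x; rewrite [(p, k).1]/= [(p, k).2]/= => xE.
exists (size p) => N N_gt0 sp /(row_mul_eq1 _ _).1 gE.
have p0 : p != 0 by apply: contraNneq x0 => p0; rewrite xE p0 rmorph0 mul0r.
have /negP := cyclic_ev_poly_neq0 N_gt0 p0 sp; apply.
have tk := unitrX k (lt_unit 'F_2).
rewrite -[poly_laurent p](divrK tk) -xE (rmorphM (cyclic_ev _ _)).
rewrite (rmorphB (cyclic_ev _ _)) -!mx_evE gE.
by rewrite (rmorph1 (mx_ev _ _ _)) subrr mul0r.
Qed.

Lemma residually_2_odd n : odd `|n|%N -> residually 2 (grpH n).
Proof.
move=> n_odd; apply: hnn_residually => // g /cd_rep_sep[m sep].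
have N_gt0 : (0 < 2 ^ m)%N by rewrite expn_gt0.
have nk := exists_pow2_odd m n_odd.
exists _, (cd_rep N_gt0), (row_subst 'F_2 N_gt0 2 N_gt0 nk)^-1%g; split.
- exact: cd_repJ.
- exact: cd_rep_2elt.
- rewrite p_eltV /p_elt (pnat_dvd (n := 2 ^ m)) ?pnatX // order_dvdn.
  by rewrite row_subst_exp.
- by apply: sep; rewrite ltnW // ltn_expl.
Qed.

(** * Even n *)

Definition c_grpG : grpG :=
  SubgroupGen (introT (in_genP _ _) (in_gen_mem (or_introl (erefl c_gen)))).

(** The modulus N = |n| + 1 is always available: n^2 = 1 modulo N, and N >= 2
    keeps the off-diagonal entry 1 + t of c nonzero. *)
Lemma c_base_neq1 (n : int) : n != 0 -> hnn_base (rhoG n) c_grpG <> 1%g.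
Proof.
move=> n0; have nk : exists z : int, n ^+ 2 = 1 + (`|n|.+1)%:Z * z.
  by exists (`|n|%:Z - 1); case: n {n0} => j /=; rewrite expr2; nia.
have N_gt0 := ltn0Sn `|n|%N.
have [|h [hf _] _] := hnn_universal (phi := rhoG n) (f := cd_rep N_gt0)
    (s := (row_subst 'F_2 N_gt0 2 (ltn0Sn 1) nk)^-1%g).
  by move=> g; apply: cd_repJ.
move=> /(congr1 h); rewrite hf gmulf1 => /(row_mul_eq1 _ _).1 /matrixP /(_ 0 1).
have cE : uval (gen_val c_grpG) 0 1 = poly_laurent ('X + 1).
  by rewrite [LHS]mxE rmorphD rmorph1 addrC.
rewrite mx_evE cE mxE.
apply/eqP/cyclic_ev_poly_neq0; last by rewrite size_XaddC; lia.
by rewrite -size_poly_gt0 size_XaddC.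
Qed.

(** A conjugate of x has the order of x, but x^n has smaller order when x is a
    nontrivial p-element and p divides n. *)
Lemma zexpg_conj_pelt (p : nat) (P : finGroupType) (x y : P) (n : int) :
    prime p -> (p.-elt x)%g -> (p %| `|n|)%N -> (x ^ y)%g = zexpg x n ->
  x = 1%g.
Proof.
move=> p_pr xp pn xy; apply/eqP; rewrite -order_eq1.
have ox : #[x ^+ `|n|]%g = #[x]%g.
  by rewrite -[RHS](orderJ x y) xy; case: {pn xy} n => j //; rewrite orderV.
rewrite orderXgcd in ox; have x_gt0 := order_gt0 x.
have g1 : gcdn #[x]%g `|n| = 1%N.
  by apply/eqP; rewrite -(eqn_pmul2l x_gt0) muln1 -{1}ox divnK // dvdn_gcdl.
have : coprime #[x]%g p by apply: coprime_dvdr pn _; rewrite /coprime g1.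
rewrite coprime_sym prime_coprime // -p'natE // => xp'.
by apply/eqP/(pnat_1 xp).
Qed.

Lemma residually_2_even n : n != 0 -> residually 2 (grpH n) -> odd `|n|%N.
Proof.
move=> n0 res; apply/negPn/negP => n_even.
have [P [h [P2 hc]]] := res _ (c_base_neq1 n0).
apply/hc/(@zexpg_conj_pelt 2 _ _ (h (hnn_tau (rhoG n)))^-1%g n) => //.
- by apply: mem_p_elt P2 _; rewrite inE.
- by rewrite dvdn2.
have rc : rhoG n c_grpG = zexpg c_grpG n.
  apply: val_inj; rewrite -[LHS]/(rho n c_gen) rho_c.
  by rewrite -[RHS]/(gen_val_morph (zexpg c_grpG n)) gmulf_zexpg.
rewrite /conjg invgK mulgA -gmulfV -!gmulfM hnn_tauJ.
rewrite -(gmulf_zexpg h) -(gmulf_zexpg (hnn_base (rhoG n))).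
by congr (h (hnn_base _ _)); apply: rc.
Qed.

End Answer.

Local Open Scope ring_scope.

Theorem theorem1p5 (n : int) (n_neq0 : n != 0) :
  residually 2 (grpH n) <-> odd `|n|%N.
Proof. by split; [exact: residually_2_even | exact: residually_2_odd]. Qed.
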